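(* Let $m$ be a positive integer, $r$ a nonnegative integer, $\lambda\in\mathbb{R}$, and $0\le k\le n$. Then $$V_{m,m\lambda}^{(r)}(n,k)=\sum_{i=k}^{n}\binom{i}{k}m^{n-i}S_{1,\lambda}(n,i)(-r)_{i-k,m\lambda}.$$
   Context: $(x)_{0,\lambda}=1$, $(x)_{n,\lambda}=x(x-\lambda)\cdots(x-(n-1)\lambda)$, $(x)_n=(x)_{n,1}$. The degenerate Stirling numbers of the first kind are defined by $(x)_n=\sum_{k=0}^n S_{1,\lambda}(n,k)(x)_{k,\lambda}$. For a positive integer $m$, nonnegative integer $r$ and real $\mu$, the degenerate $r$-Whitney numbers of the first kind $V_{m,\mu}^{(r)}(n,k)$ are defined by $m^n(x)_n=\sum_{k=0}^n V_{m,\mu}^{(r)}(n,k)(mx+r)_{k,\mu}$ (polynomial identity in $x$). *)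

(* Defs.v *)
From HB Require Import structures.
From mathcomp Require Export all_boot all_order all_algebra.
From mathcomp Require Export boolp classical_sets reals.

Set Implicit Arguments.
Unset Strict Implicit.
Unset Printing Implicit Defensive.

Import GRing.Theory.

Local Open Scope ring_scope.

(* (x)_{n,lam}; used both for scalars and, with A := {poly R}, for polynomials *)
Definition dfall (A : comNzRingType) (lam x : A) (n : nat) : A :=
  \prod_(i < n) (x - i%:R * lam).

(* [c] lists the coefficients of [p] on b_0, ..., b_n, extended by 0 *)
Definition is_expansion (R : realType) (b : nat -> {poly R}) (n : nat)
    (p : {poly R}) (c : nat -> R) : Prop :=
  p = \sum_(k < n.+1) c k *: b k /\ (forall k : nat, (n < k)%N -> c k = 0).

(* The unique such [c] when b_k has degree k and p has degree at most n
   (see [expansionP] and [expansion_uniq]); 0 if there is none. *)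
Definition expansion (R : realType) (b : nat -> {poly R}) (n : nat)
    (p : {poly R}) : nat -> R :=
  xget (fun=> 0) (is_expansion b n p).

(* S_{1,lam}(n,k) : (x)_n = \sum_(k <= n) S_{1,lam}(n,k) (x)_{k,lam} *)
Definition degStirling1 (R : realType) (lam : R) (n k : nat) : R :=
  expansion (dfall lam%:P 'X) n (dfall 1 'X n) k.

(* V_{m,mu}^{(r)}(n,k) :
   m^n (x)_n = \sum_(k <= n) V_{m,mu}^{(r)}(n,k) (m x + r)_{k,mu} *)
Definition degWhitney1 (R : realType) (m r : nat) (mu : R) (n k : nat) : R :=
  expansion (dfall mu%:P (m%:R * 'X + r%:R)) n (m%:R ^+ n * dfall 1 'X n) k.

Section Expansion.
Variables (R : realType) (b : nat -> {poly R}).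
Hypothesis size_b : forall k, size (b k) = k.+1.

Let lead_b k : (b k)`_k != 0.
Proof.
by have := lead_coef_eq0 (b k); rewrite lead_coefE size_b -size_poly_eq0 size_b /= => ->.
Qed.

Lemma expansion_exists n (p : {poly R}) :
  (size p <= n.+1)%N -> exists c, is_expansion b n p c.
Proof.
elim: n p => [|n IH] p sp.
  exists (fun k => if k == 0%N then p`_0 / (b 0%N)`_0 else 0); split; last by case.
  rewrite big_ord1 /= (size1_polyC sp) coefC /=.
  have h : (size (b 0%N) <= 1)%N by rewrite size_b.
  by rewrite {2}(size1_polyC h) -mul_polyC -polyCM divfK // lead_b.
pose a := p`_n.+1 / (b n.+1)`_n.+1.
have [|c [pE c0]] := IH (p - a *: b n.+1).
  apply/leq_sizeP => j; rewrite leq_eqVlt => /orP[/eqP <-|lt_nj].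
    by rewrite coefB coefZ divfK ?subrr // lead_b.
  rewrite coefB coefZ (nth_default _ (leq_trans sp lt_nj)).
  by rewrite [(b _)`_j]nth_default ?size_b // mulr0 subr0.
exists (fun k => if k == n.+1 then a else c k); split.
  rewrite big_ord_recr /= eqxx -[LHS](subrK (a *: b n.+1)) pE; congr (_ + _).
  by apply: eq_bigr => i _; rewrite ltn_eqF.
by move=> k lt_k; rewrite gtn_eqF // c0 // ltnW.
Qed.

Lemma expansion_uniq n (p : {poly R}) c d :
  is_expansion b n p c -> is_expansion b n p d -> c = d.
Proof.
elim: n p c d => [|n IH] p c d [pc c0] [pd d0].
  apply/funext => -[|k]; last by rewrite c0 ?d0.
  have /(congr1 (fun q : {poly R} => q`_0)) := etrans (esym pc) pd.
  by rewrite !big_ord1 !coefZ => /(mulIf (lead_b 0)).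
have coefE (e : nat -> R) : (\sum_(k < n.+2) e k *: b k)`_n.+1 = e n.+1 * (b n.+1)`_n.+1.
  rewrite big_ord_recr /= coefD coefZ coef_sum big1 ?add0r // => i _.
  by rewrite coefZ [(b _)`_ _]nth_default ?mulr0 // size_b.
have cd : c n.+1 = d n.+1.
  by apply: (mulIf (lead_b n.+1)); rewrite -!coefE -pc -pd.
have E (e : nat -> R) : is_expansion b n (\sum_(k < n.+1) e k *: b k)
    (fun k => if (k < n.+1)%N then e k else 0).
  by split=> [|k]; [apply: eq_bigr => i _; rewrite ltn_ord | rewrite ltnNge ltnS => /negPf ->].
have := etrans (esym pc) pd.
rewrite [LHS]big_ord_recr [RHS]big_ord_recr /= cd => /addIr Ecd.
have := E c; rewrite {1}Ecd => Ec; have h := IH _ _ _ Ec (E d).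
apply/funext => k; have [lt_k|] := ltnP k n.+1.
  by have := congr1 (fun f => f k) h; rewrite lt_k.
by rewrite leq_eqVlt => /orP[/eqP <- //|lt_k]; rewrite c0 ?d0.
Qed.

Lemma expansionP n (p : {poly R}) :
  (size p <= n.+1)%N -> is_expansion b n p (expansion b n p).
Proof. by move=> /expansion_exists /xgetPex; apply. Qed.

End Expansion.

Lemma size_dfall (R : realType) (lam : R) (q : {poly R}) n :
  size q = 2%N -> size (dfall lam%:P q n) = n.+1.
Proof.
move=> sq; rewrite /dfall.
have sB i : size (q - i%:R * lam%:P) = 2%N.
  by rewrite -polyC_natr -polyCM size_polyDl // sq ltnS size_polyN size_polyC_leq1.
elim: n => [|n IH]; first by rewrite big_ord0 size_poly1.
by rewrite big_ord_recr /= size_mul -?size_poly_eq0 ?IH ?sB // addn2.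
Qed.

Lemma degStirling1P (R : realType) (lam : R) (n : nat) :
  dfall 1 'X n = \sum_(k < n.+1) degStirling1 lam n k *: dfall lam%:P 'X k.
Proof.
have h k : size (dfall lam%:P 'X k) = k.+1 by apply: size_dfall; rewrite size_polyX.
have s : (size (dfall 1 'X n : {poly R}) <= n.+1)%N.
  by rewrite -[1]/(1%:P) size_dfall ?size_polyX.
by have [] := expansionP h s.
Qed.

Lemma degWhitney1P (R : realType) (m r : nat) (mu : R) (n : nat) :
  (0 < m)%N ->
  m%:R ^+ n * dfall 1 'X n =
  \sum_(k < n.+1) degWhitney1 m r mu n k *: dfall mu%:P (m%:R * 'X + r%:R) k.
Proof.
move=> m0; have mN0 : m%:R != 0 :> R by rewrite Num.Theory.pnatr_eq0 -lt0n.
have h k : size (dfall mu%:P (m%:R * 'X + r%:R : {poly R}) k) = k.+1.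
  apply: size_dfall; have e : size (m%:R * 'X : {poly R}) = 2%N.
    by rewrite -polyC_natr mul_polyC size_scale // size_polyX.
  by rewrite size_polyDl // e -polyC_natr ltnS size_polyC_leq1.
have s : (size (m%:R ^+ n * dfall 1 'X n : {poly R})%R <= n.+1)%N.
  rewrite -polyC_natr -polyC_exp mul_polyC (leq_trans (size_scale_leq _ _)) //.
  by rewrite -[1]/(1%:P) size_dfall ?size_polyX.
by have [] := expansionP h s.
Qed.

(* Main.v *)
Require Import Defs.
Import GRing.Theory Num.Theory.
Local Open Scope ring_scope.

(** Since [m^i (x)_{i,lam} = (mx)_{i,m lam}] and [mx = (mx + r) + (-r)], the
    Vandermonde convolution for degenerate falling factorials re-expands
    [m^n (x)_n = \sum_i m^(n-i) S_{1,lam}(n,i) (mx)_{i,m lam}] in the basis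
    [(mx + r)_{k,m lam}]; its coefficients there are unique. *)

Lemma dfall0 (A : comNzRingType) (lam x : A) : dfall lam x 0 = 1.
Proof. by rewrite /dfall big_ord0. Qed.

Lemma dfallS (A : comNzRingType) (lam x : A) n :
  dfall lam x n.+1 = dfall lam x n * (x - n%:R * lam).
Proof. by rewrite /dfall big_ord_recr. Qed.

Lemma dfallMl (A : comNzRingType) (a lam x : A) n :
  dfall (a * lam) (a * x) n = a ^+ n * dfall lam x n.
Proof.
elim: n => [|n IHn]; first by rewrite !dfall0 mulr1.
by rewrite !dfallS IHn exprSr [n%:R * _]mulrCA -mulrBr mulrACA.
Qed.

Lemma dfall_polyC (A : comNzRingType) (lam x : A) n :
  dfall lam%:P x%:P n = (dfall lam x n)%:P.
Proof.
rewrite /dfall rmorph_prod; apply: eq_bigr => i _.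
by rewrite /= polyCB polyCM polyC_natr.
Qed.

(** Induction on [n]: in the [k]-th term the new factor [x + y - n%:R * lam] splits into the next
    factor of [dfall lam x k] plus the next factor of [dfall lam y (n - k)]. Pascal's rule then
    merges the two resulting sums. *)
Lemma dfallD (A : comNzRingType) (lam x y : A) n :
  dfall lam (x + y) n =
  \sum_(k < n.+1) 'C(n, k)%:R * dfall lam x k * dfall lam y (n - k).
Proof.
elim: n => [|n IHn]; first by rewrite big_ord1 !dfall0 !mulr1.
have -> : dfall lam (x + y) n.+1 =
    \sum_(k < n.+1) 'C(n, k)%:R * dfall lam x k.+1 * dfall lam y (n - k) +
    \sum_(k < n.+1) 'C(n, k)%:R * dfall lam x k * dfall lam y (n.+1 - k).
  rewrite dfallS IHn mulr_suml -big_split /=; apply: eq_bigr => k _.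
  have le_kn : (k <= n)%N by rewrite -ltnS.
  have -> : x + y - n%:R * lam = (x - k%:R * lam) + (y - (n - k)%:R * lam).
    by rewrite addrACA -opprD -mulrDl -natrD subnKC.
  by rewrite subSn // !dfallS mulrDr !mulrA [in X in X + _]mulrAC.
(* The [k = 0] term occurs only in the second sum; once it is split off, the remaining indices are
   shifted by one and Pascal's rule applies. *)
rewrite [X in _ + X]big_ord_recl [RHS]big_ord_recl /= !bin0 addrCA.
congr (_ + _).
under [RHS]eq_bigr => k _ do rewrite /bump /= add1n binS natrD !mulrDl subSS.
rewrite big_split /= addrC; congr (_ + _).
(* The right-hand sum has one extra term, with coefficient ['C(n, n.+1) = 0]. *)
rewrite [RHS]big_ord_recr /= bin_small // !mul0r addr0.
by apply: eq_bigr => k _; rewrite /bump /= add1n subSS.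
Qed.

(** The witness [c] rules out the default value of [xget], so [expansion] is a genuine expansion,
    and uniqueness identifies it with [c]. *)
Lemma expansion_eq (R : realType) (b : nat -> {poly R}) n (p : {poly R})
    (c : nat -> R) :
  (forall k, size (b k) = k.+1) -> is_expansion b n p c ->
  expansion b n p = c.
Proof.
move=> size_b pc; apply: expansion_uniq (pc) => //.
by apply: xgetPex; exists c.
Qed.

Lemma size_natrMXaddn (R : numDomainType) (m r : nat) :
  (0 < m)%N -> size (m%:R * 'X + r%:R : {poly R}) = 2%N.
Proof.
move=> m_gt0; have size_mX : size (m%:R * 'X : {poly R}) = 2%N.
  by rewrite -polyC_natr mul_polyC size_scale ?size_polyX // pnatr_eq0 -lt0n.
by rewrite size_polyDl // size_mX -polyC_natr ltnS size_polyC_leq1.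
Qed.

Lemma is_expansion_degWhitney1 (R : realType) (m r : nat) (lam : R) n :
  is_expansion (dfall (m%:R * lam)%:P (m%:R * 'X + r%:R)) n
    (m%:R ^+ n * dfall 1 'X n)
    (fun k => \sum_(k <= i < n.+1)
       'C(i, k)%:R * m%:R ^+ (n - i) * degStirling1 lam n i
         * dfall (m%:R * lam) (- r%:R) (i - k)).
Proof.
split=> [|k lt_nk]; last by rewrite big_geq.
set y := m%:R * 'X + r%:R.
(* The range is [n.+1] with the guard [k <= i], instead of [i.+1], to match the inner sum obtained
   by exchanging summations below. *)
have termE i : (i <= n)%N -> m%:R ^+ i * dfall lam%:P 'X i =
    \sum_(k < n.+1 | (k <= i)%N)
      ('C(i, k)%:R * dfall (m%:R * lam) (- r%:R) (i - k))
        *: dfall (m%:R * lam)%:P y k.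
  move=> le_in; have -> : m%:R ^+ i * dfall lam%:P 'X i =
      dfall (m%:R * lam)%:P (y + (- r%:R)%:P) i.
    by rewrite /y polyCN polyC_natr addrK polyCM polyC_natr dfallMl.
  rewrite dfallD (big_ord_widen n.+1 (fun k => 'C(i, k)%:R
    * dfall (m%:R * lam)%:P y k
    * dfall (m%:R * lam)%:P (- r%:R)%:P (i - k))) //; apply: eq_bigr => k _.
  by rewrite dfall_polyC -mul_polyC (polyCM 'C(i, k)%:R) polyC_natr mulrAC.
(* Turning the lower bound on [i] into a guard gives both sums the fixed range [n.+1], so they can
   be swapped and compared for each [i]. *)
under eq_bigr => k _ do rewrite big_geq_mkord scaler_suml.
rewrite (degStirling1P lam) mulr_sumr (exchange_big_dep xpredT) //=.
apply: eq_bigr => i _; have le_in : (i <= n)%N by rewrite -ltnS.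
(* Of the [n] powers of [m], exactly [i] are absorbed by the falling factorial through [termE]; the
   other [n - i] stay in the coefficient. *)
have -> : m%:R ^+ n * (degStirling1 lam n i *: dfall lam%:P 'X i) =
    (m%:R ^+ (n - i) * degStirling1 lam n i) *:
      (m%:R ^+ i * dfall lam%:P 'X i).
  rewrite -{1}(subnK le_in) exprD -!mul_polyC polyCM polyC_exp polyC_natr.
  by rewrite -!mulrA; congr (_ * _); rewrite mulrCA.
rewrite termE // scaler_sumr.
by apply: eq_bigr => k _; rewrite scalerA mulrCA !mulrA.
Qed.

Theorem theorem3 (R : realType) (m r : nat) (lam : R) (n k : nat)
    (hm : (0 < m)%N) (hkn : (k <= n)%N) :
  degWhitney1 m r (m%:R * lam) n k =
  \sum_(k <= i < n.+1)
    'C(i, k)%:R * m%:R ^+ (n - i) * degStirling1 lam n i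
      * dfall (m%:R * lam) (- r%:R) (i - k).
Proof.
rewrite /degWhitney1.
rewrite (expansion_eq _ _ _ _ _ _ (is_expansion_degWhitney1 R m r lam n)) //.
(* Uniqueness needs a basis element of degree exactly [j]; [hm] ensures this by making [m x + r] of
   degree 1. *)
by move=> j; apply/size_dfall/size_natrMXaddn.
Qed.
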